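(* Let $X$ be a finite nonempty set, let $p=(p_x)_{x\in X}$ be a probability vector with $p_x>0$ for all $x\in X$, and let $\mu_p$ be the Bernoulli measure with weight $p$ on the space $X^{-\omega}$ of left-infinite sequences over $X$. Let $\Gamma=(V,E)$ be a finite directed graph with edges labeled by elements of $X$, and suppose $\Gamma$ is right-resolving. Put $\mu_p(\Gamma)=\sum_{v\in V}\mu_p(F_v)$. Then $$\mu_p(\Gamma)=\min_{w\in X^{-\omega}}|V(w)|=\min_{w\in X^*}|V(w)|.$$ In particular, $\mu_p(\Gamma)$ is an integer.
   Context: $X^*$ is the set of all finite words over $X$ (including the empty word); $X^{-\omega}$ is the set of left-infinite sequences $\ldots x_2x_1$, $x_i\in X$, with the product topology. The Bernoulli measure $\mu_p$ on $X^{-\omega}$ is the Borel probability measure assigning to the cylinder of all sequences ending with $x_n\ldots x_2x_1$ the value $p_{x_n}\cdots p_{x_2}p_{x_1}$. A labeled directed graph is right-resolving if for every vertex $v$ the edges starting at $v$ have pairwise different labels. A sequence $\ldots x_2x_1\in X^{-\omega}$ (a word $x_n\ldots x_2x_1\in X^*$) ends in the vertex $v$ if there is a left-infinite path $\ldots e_2e_1$ (a finite path $e_n\ldots e_2e_1$) in $\Gamma$ that ends in $v$ and such that $e_i$ is labeled by $x_i$ for all $i$ (the empty word ends in every vertex). For $w\in X^*\cup X^{-\omega}$, $V(w)\subseteq V$ is the set of vertices in which $w$ ends. For $v\in V$, $F_v\subseteq X^{-\omega}$ is the set of all left-infinite sequences that end in $v$. *)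

(* Defs.v *)
(* MathComp / MathComp-Analysis *)
From HB Require Import structures.
From mathcomp Require Import all_boot all_order all_algebra.
From mathcomp Require Import all_classical all_reals all_analysis.

Set Implicit Arguments.
Unset Strict Implicit.
Unset Printing Implicit Defensive.

Import Order.TTheory GRing.Theory Num.Theory.

Local Open Scope classical_set_scope.
Local Open Scope ring_scope.

(* Finite nonempty alphabets.  The point only records nonemptiness, which
   measurable types require; nothing else depends on the choice of it. *)
#[short(type="pointedFinType")]
HB.structure Definition PointedFinite := {T of Finite T & Pointed T}.

(* A left-infinite sequence ... x_3 x_2 x_1 is indexed from the right:
   [w i] is the letter x_(i+1).  A finite word x_n ... x_1 is a [seq X] in
   reading order, [:: x_n; ...; x_1]. *)
Definition left_seq (X : pointedFinType) : Type :=
  prod_topology (fun _ : nat => discrete_topology X).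

HB.instance Definition _ (X : pointedFinType) := Pointed.on (left_seq X).
HB.instance Definition _ (X : pointedFinType) := Topological.on (left_seq X).

Definition borel_left_seq (X : pointedFinType) :=
  g_sigma_algebraType (@open (left_seq X)).

Definition cylinder (X : pointedFinType) (s : seq X) : set (left_seq X) :=
  [set w | rev (mkseq w (size s)) = s].

Definition prob_vector (R : realType) (X : finType) (p : X -> R) : Prop :=
  (forall x, 0 <= p x) /\ \sum_(x : X) p x = 1.

(* Cylinders form a pi-system generating the Borel sets, so this determines
   mu uniquely. *)
Definition bernoulli_measure (R : realType) (X : pointedFinType) (p : X -> R)
    (mu : probability (borel_left_seq X) R) : Prop :=
  forall s : seq X, mu (cylinder s) = (\prod_(x <- s) p x)%:E.

(* Loops and parallel edges are allowed. *)
Record lgraph (X : Type) := LGraph {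
  vert : finType;
  edge : finType;
  src : edge -> vert;
  tgt : edge -> vert;
  lab : edge -> X }.

Section Graph.
Context {X : pointedFinType} (G : lgraph X).

Definition right_resolving : Prop :=
  forall e f : edge G, src e = src f -> lab e = lab f -> e = f.

(* [es] is a path from a to b; the empty path goes from a to a. *)
Fixpoint walk (a b : vert G) (es : seq (edge G)) : Prop :=
  if es is e :: es' then src e = a /\ walk (tgt e) b es' else a = b.

Definition word_ends_in (s : seq X) (v : vert G) : Prop :=
  exists (a : vert G) (es : seq (edge G)),
    walk a v es /\ map (@lab X G) es = s.

(* [e i] is the edge e_(i+1) of the left-infinite path ... e_2 e_1. *)
Definition seq_ends_in (w : left_seq X) (v : vert G) : Prop :=
  exists e : nat -> edge G,
    [/\ forall i, tgt (e i.+1) = src (e i),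
        tgt (e 0%N) = v
      & forall i, lab (e i) = w i].

Definition Vword (s : seq X) : {set vert G} :=
  [set v | `[< word_ends_in s v >]]%SET.

Definition Vseq (w : left_seq X) : {set vert G} :=
  [set v | `[< seq_ends_in w v >]]%SET.

Definition Fset (v : vert G) : set (left_seq X) := [set w | seq_ends_in w v].

Definition graph_measure (R : realType)
    (mu : probability (borel_left_seq X) R) : \bar R :=
  (\sum_(v : vert G) mu (Fset v))%E.

End Graph.

Definition is_min (S : set nat) (m : nat) : Prop := S m /\ lbound S m.

(* Main.v *)
Require Import Defs.
From mathcomp Require Import all_boot all_order all_algebra.
From mathcomp Require Import all_classical all_reals all_analysis.
From mathcomp Require Import measurable_realfun.

Set Implicit Arguments.
Unset Strict Implicit.
Unset Printing Implicit Defensive.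

Import Order.TTheory GRing.Theory Num.Theory.

Local Open Scope classical_set_scope.
Local Open Scope ring_scope.

(** Appending letters on the right of a word s cannot increase |V(s)|, because
    Gamma is right-resolving, and prepending letters on the left shrinks V(s);
    hence |V(a s b)| <= |V(s)|.  Let s0 be a word minimizing |V(s)|, with
    minimum m.  By compactness V(w) = V(s) for every long enough suffix s of w,
    so |V(w)| >= m, with equality as soon as w contains s0.  Almost every w
    contains s0, and mu_p(Gamma) is the integral of |V(w)|, so it equals m. *)

(** If every [x] failed at some stage [N x], then, failure being permanent, all would fail at the
    maximum of the [N x]. This is the compactness used below for edges and for vertices. *)
Lemma fin_decreasing_ex (T : finType) (P : nat -> T -> Prop) :
    (forall n x, P n.+1 x -> P n x) -> (forall n, exists x, P n x) ->
  exists x, forall n, P n x.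
Proof.
move=> Pdec Pex; apply: contrapT => noP.
have /choice[N HN] : forall x, exists n, ~ P n x.
  by move=> x; apply/existsNP => Px; apply: noP; exists x.
have Ple n x d : P (n + d)%N x -> P n x.
  by elim: d n => [|d IHd] n; rewrite ?addn0// addnS => /Pdec/IHd.
have [x] := Pex (\max_(x : T) N x)%N.
by rewrite -(subnKC (leq_bigmax x)) => /Ple /HN.
Qed.

(** * Vertices in which a finite word ends *)

Section Words.
Variables (X : pointedFinType) (G : lgraph X).
Implicit Types (s t : seq X) (v : vert G) (w : left_seq X).

Lemma walk_cat a b (es fs : seq (edge G)) :
  walk a b (es ++ fs) <-> exists2 c, walk a c es & walk c b fs.
Proof.
elim: es a => [|e es IHes] a /=.
  by split=> [|[c -> //]]; exists a.
by rewrite IHes; split=> [[? [c]]|[c [?]]] *; [exists c|split=> //; exists c].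
Qed.

Lemma word_ends_in_cat s t v : word_ends_in (s ++ t) v -> word_ends_in t v.
Proof.
move=> [a [es [+ est]]]; rewrite -(cat_take_drop (size s) es) walk_cat.
case=> c _ ?; exists c, (drop (size s) es); split=> //.
by rewrite map_drop est drop_size_cat.
Qed.

Lemma word_ends_in_rcons s x v :
  word_ends_in (rcons s x) v <->
  exists e : edge G, [/\ tgt e = v, lab e = x & word_ends_in s (src e)].
Proof.
split=> [[a [es []]]|[e [<- <- [a [es [aes <-]]]]]]; last first.
  exists a, (rcons es e); rewrite map_rcons -cats1 walk_cat; split=> //.
  by exists (src e).
case/lastP: es => [|es e]; first by case: s.
rewrite map_rcons -cats1 walk_cat => -[c aes [ec /= ev]].
move=> /rcons_inj[<- <-]; exists e; split=> //.
by exists a, es; rewrite ec.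
Qed.

Lemma VwordP s v : reflect (word_ends_in s v) (v \in Vword G s).
Proof. by rewrite inE; exact: asboolP. Qed.

Lemma VseqP w v : reflect (seq_ends_in w v) (v \in Vseq G w).
Proof. by rewrite inE; exact: asboolP. Qed.

Lemma Vword_cat s t : Vword G (s ++ t) \subset Vword G t.
Proof.
by apply/fintype.subsetP => v /VwordP/word_ends_in_cat tv; exact/VwordP.
Qed.

Hypothesis G_rr : right_resolving G.

(** The edges labeled [x] that start in V(s) inject into V(s) by their sources, since the graph is
    right-resolving, and their targets cover V(sx). *)
Lemma card_Vword_rcons s x : (#|Vword G (rcons s x)| <= #|Vword G s|)%N.
Proof.
pose E := [set e : edge G | (src e \in Vword G s) && (lab e == x)]%SET.
have srcE : {in E &, injective (@src X G)}.
  move=> e f; rewrite !inE => /andP[_ /eqP ex] /andP[_ /eqP fx] ?.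
  by apply: G_rr; rewrite // ex fx.
apply: (@leq_trans #|[set src e | e in E]%SET|); last first.
  apply/subset_leq_card/fintype.subsetP => _ /imsetP[e + ->].
  by rewrite inE => /andP[].
rewrite (card_in_imset srcE).
apply: leq_trans (leq_imset_card (@tgt X G) (mem E)).
apply/subset_leq_card/fintype.subsetP => v /VwordP/word_ends_in_rcons[e [<- ex se]].
by apply: imset_f; rewrite inE; apply/andP; split; [apply/VwordP|apply/eqP].
Qed.

Lemma card_Vword_catr s t : (#|Vword G (s ++ t)| <= #|Vword G s|)%N.
Proof.
elim/last_ind: t => [|t x IHt]; first by rewrite cats0.
by rewrite -rcons_cat (leq_trans (card_Vword_rcons _ _)).
Qed.

Lemma card_Vword_factor a s b : (#|Vword G (a ++ s ++ b)| <= #|Vword G s|)%N.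
Proof.
exact: leq_trans (subset_leq_card (Vword_cat _ _)) (card_Vword_catr _ _).
Qed.

End Words.

(** * Left-infinite sequences and their finite suffixes *)

Definition suffix_word (X : pointedFinType) (w : left_seq X) n : seq X :=
  rev (mkseq w n).

Section Sequences.
Variables (X : pointedFinType) (G : lgraph X).
Implicit Types (s t : seq X) (v : vert G) (w : left_seq X).

Lemma size_suffix_word w n : size (suffix_word w n) = n.
Proof. by rewrite size_rev size_mkseq. Qed.

Lemma suffix_wordS w n : suffix_word w n.+1 = w n :: suffix_word w n.
Proof. by rewrite /suffix_word mkseqS rev_rcons. Qed.

Lemma suffix_word_rcons w n :
  suffix_word w n.+1 = rcons (suffix_word ((w \o S) : left_seq X) n) (w 0%N).
Proof.
by elim: n => // n IHn; rewrite suffix_wordS IHn -rcons_cons -suffix_wordS.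
Qed.

(** Truncating a path gives one direction. Conversely, a path is built from right to left, keeping
    its current start a vertex in which all suffixes of the unread part of [w] end. *)
Lemma seq_ends_inP w v :
  seq_ends_in w v <-> forall n, word_ends_in (suffix_word w n) v.
Proof.
(* [shift i] is [w] with its last [i] letters removed. *)
pose shift i : left_seq X := fun j => w (i + j)%N.
have shiftS i n :
    suffix_word (shift i) n.+1 = rcons (suffix_word (shift i.+1) n) (w i).
  rewrite suffix_word_rcons /shift addn0; congr (rcons (suffix_word _ _) _).
  by apply/funext => j /=; rewrite addnS.
split=> [[e [e_tgt <- e_lab]] n|wv].
  suff ends i : word_ends_in (suffix_word (shift i) n) (tgt (e i)).
    exact: (ends 0%N).
  elim: n i => [|n IHn] i; first by exists (tgt (e i)), [::].
  rewrite shiftS word_ends_in_rcons; exists (e i); split=> //.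
  by rewrite -e_tgt.
pose good i (u : vert G) := forall n, word_ends_in (suffix_word (shift i) n) u.
(* Koenig's lemma; suffix_word (shift i) n is the word w (i + n - 1) ... w i. *)
have step i u : good i u -> exists e : edge G,
    [/\ tgt e = u, lab e = w i & good i.+1 (src e)].
  move=> iu; have [] := @fin_decreasing_ex (edge G)
    (fun n e => [/\ tgt e = u, lab e = w i
                  & word_ends_in (suffix_word (shift i.+1) n) (src e)]).
  - by move=> n e [-> -> +]; rewrite suffix_wordS -cat1s => /word_ends_in_cat.
  - by move=> n; apply/word_ends_in_rcons; rewrite -shiftS.
  - move=> e He; exists e; case: (He 0%N) => ? ? _; split=> // n.
    by case: (He n).
have [e0 _] := step 0%N v wv.
(* The choice function must be total; [e0] is the default at pairs that are not good. *)
have /choice[f fP] (iu : nat * vert G) : exists e : edge G, good iu.1 iu.2 ->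
    [/\ tgt e = iu.2, lab e = w iu.1 & good iu.1.+1 (src e)].
  by have [/step[e]|] := pselect (good iu.1 iu.2); [exists e|exists e0].
pose e := fix e i := if i is j.+1 then f (i, src (e j)) else f (0%N, v).
have eS i : good i.+1 (src (e i)).
  by elim: i => [|i IHi]; [case: (fP (0%N, v) wv)|case: (fP (_, _) IHi)].
exists e; split=> [i||[|i]]; first by case: (fP (_, _) (eS i)).
- by case: (fP (0%N, v) wv).
- by case: (fP (0%N, v) wv).
- by case: (fP (_, _) (eS i)).
Qed.

Lemma Vseq_sub_Vword w n : Vseq G w \subset Vword G (suffix_word w n).
Proof.
apply/fintype.subsetP => v /VseqP/seq_ends_inP wv.
exact/VwordP.
Qed.

(** Otherwise each suffix ends in some vertex outside V(w); by compactness one such vertex serves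
    all suffixes, and then [w] itself ends there. *)
Lemma Vword_sub_Vseq w : exists n, Vword G (suffix_word w n) \subset Vseq G w.
Proof.
apply: contrapT => nosub.
have [||v vP] := @fin_decreasing_ex (vert G)
  (fun n v => word_ends_in (suffix_word w n) v /\ ~ seq_ends_in w v).
- by move=> n v [+ ?]; rewrite suffix_wordS -cat1s => /word_ends_in_cat.
- move=> n.
  have /fintype.subsetPn[v] :
      ~~ (Vword G (suffix_word w n) \subset Vseq G w).
    by apply/negP => sub; apply: nosub; exists n.
  by move=> /VwordP wv /VseqP wNv; exists v.
- by case: (vP 0%N) => _; apply; apply/seq_ends_inP => n; case: (vP n).
Qed.

Lemma open_letter (i : nat) (x : X) : open [set w : left_seq X | w i = x].
Proof.
apply: (@open_comp (left_seq X) (discrete_topology X) (fun w => w i) [set x]).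
  by move=> w _; exact: (@proj_continuous nat (fun _ => discrete_topology X) i w).
exact: discrete_open.
Qed.

(** The set is a union of cylinders, and a cylinder is a finite intersection of conditions on single
    letters. *)
Lemma open_suffix_word (P : set (seq X)) n :
  open [set w : left_seq X | P (suffix_word w n)].
Proof.
rewrite (_ : [set _ | _] =
    \bigcup_(s in P) [set w : left_seq X | suffix_word w n = s]); last first.
  by apply/seteqP; split=> w /= => [?|[s Ps ->//]]; exists (suffix_word w n).
apply: bigcup_open => s _; elim: n s => [|n IHn] s.
  have [<-|s0] := eqVneq [::] s.
    rewrite (_ : [set _ | _] = setT); first exact: openT.
    by apply/seteqP; split.
  rewrite (_ : [set _ | _] = set0); first exact: open0.
  by apply/seteqP; split=> // w /= s0'; rewrite -s0' eqxx in s0.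
case: s => [|x s].
  rewrite (_ : [set _ | _] = set0); first exact: open0.
  by apply/seteqP; split=> // w /=; rewrite suffix_wordS.
rewrite (_ : [set _ | _] = [set w : left_seq X | w n = x] `&`
    [set w : left_seq X | suffix_word w n = s]).
  exact: openI (open_letter n x) (IHn s).
by apply/seteqP; split=> w /=; rewrite suffix_wordS; case=> -> ->.
Qed.

Lemma measurable_suffix_word (P : set (seq X)) n :
  measurable ([set w | P (suffix_word w n)] : set (borel_left_seq X)).
Proof. by apply: sub_sigma_algebra; exact: open_suffix_word. Qed.

Lemma measurable_Fset v : measurable (Fset v : set (borel_left_seq X)).
Proof.
rewrite (_ : Fset v = \bigcap_n
    [set w : borel_left_seq X | word_ends_in (suffix_word w n) v]).
  apply: bigcapT_measurable => n.
  exact: (measurable_suffix_word [set s | word_ends_in s v]).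
by apply/seteqP; split=> w /=; [move=> /seq_ends_inP wv n _; exact: wv|
  move=> wv; apply/seq_ends_inP => n; exact: wv].
Qed.

End Sequences.

(** * Total weight of the words avoiding a given block *)

Section Words_avoiding_a_factor.
Variables (R : realType) (X : finType) (p : X -> R).
Hypothesis p_prob : prob_vector p.
Implicit Types s t : seq X.

Fixpoint words n : seq (seq X) :=
  if n is m.+1 then [seq x :: s | x <- enum X, s <- words m] else [:: [::]].

Lemma mem_words s : s \in words (size s).
Proof.
elim: s => //= x s IHs.
by rewrite (allpairs_f (fun x s => x :: s))// mem_enum.
Qed.

Lemma sum_words n : \sum_(s <- words n) \prod_(x <- s) p x = 1.
Proof.
elim: n => [|n IHn] /=; first by rewrite big_seq1 big_nil.
rewrite big_allpairs_dep/= -[RHS](p_prob.2) big_enum/=; apply: eq_bigr => x _.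
under eq_bigr do rewrite big_cons.
by rewrite -big_distrr/= IHn mulr1.
Qed.

Variable s0 : seq X.

(* The words of length k * size s0 none of whose k consecutive blocks of length
   size s0 is s0; [rem] suffices because [words] has no duplicates. *)
Fixpoint block_avoiding k : seq (seq X) :=
  if k is j.+1 then
    [seq t ++ s | t <- rem s0 (words (size s0)), s <- block_avoiding j]
  else [:: [::]].

(** Weights are multiplicative, and each block independently ranges over all words of its length
    except [s0]. *)
Lemma sum_block_avoiding k :
  \sum_(s <- block_avoiding k) \prod_(x <- s) p x =
  (1 - \prod_(x <- s0) p x) ^+ k.
Proof.
elim: k => [|k IHk] /=; first by rewrite big_seq1 big_nil expr0.
rewrite exprS -IHk.
have <- : \sum_(t <- rem s0 (words (size s0))) \prod_(x <- t) p x =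
    1 - \prod_(x <- s0) p x.
  have := sum_words (size s0); rewrite (big_rem s0 (mem_words s0))/=.
  by move=> /(canRL (addKr _)); rewrite addrC.
rewrite big_allpairs_dep/= big_distrl/=.
apply: eq_bigr => t _; under eq_bigr do rewrite big_cat/=.
by rewrite -big_distrr.
Qed.

Lemma mem_block_avoiding k s : size s = (k * size s0)%N ->
  s \in block_avoiding k \/ exists a b, s = a ++ s0 ++ b.
Proof.
elim: k s => [|k IHk] s; first by move=> /eqP; rewrite mul0n size_eq0 => /eqP->; left.
rewrite mulSn => ss.
have [t0|tN0] := eqVneq (take (size s0) s) s0.
  by right; exists [::], (drop (size s0) s); rewrite -{1}t0 cat_take_drop.
have st : size (take (size s0) s) = size s0 by rewrite size_takel// ss leq_addr.
have [|dk|[a [b dab]]] := IHk (drop (size s0) s).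
- by rewrite size_drop ss addKn.
- left; rewrite /= -[s](cat_take_drop (size s0)).
  apply: (allpairs_f (fun t s => t ++ s)) => //.
  have := mem_words (take (size s0) s).
  rewrite st (perm_mem (perm_to_rem (mem_words s0))) inE.
  by rewrite (negPf tN0).
- right; exists (take (size s0) s ++ a), b.
  by rewrite -catA -dab cat_take_drop.
Qed.

End Words_avoiding_a_factor.

(** * Almost every sequence contains a given word *)

Section Bernoulli.
Variables (R : realType) (X : pointedFinType) (p : X -> R).
Hypotheses (p_prob : prob_vector p) (p_gt0 : forall x, 0 < p x).
Variable mu : probability (borel_left_seq X) R.
Hypothesis mu_bernoulli : bernoulli_measure p mu.

(** A union bound over cylinders. Words of [r] whose length is not [n] only enlarge the right-hand
    side. *)
Lemma mu_suffix_word_le n (r : seq (seq X)) :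
  (mu [set w | suffix_word w n \in r] <=
   (\sum_(s <- r) \prod_(x <- s) p x)%:E)%E.
Proof.
elim: r => [|s r IHr].
  rewrite big_nil (_ : [set _ | _] = set0) ?measure0//.
  by apply/seteqP; split.
rewrite big_cons EFinD -mu_bernoulli.
have cylE : cylinder s = [set w | suffix_word w (size s) = s] by [].
apply: le_trans (leeD2l _ IHr); apply: le_trans (measureU2 _ _ _).
- apply: le_measure; rewrite ?inE.
  + exact: (measurable_suffix_word [set t | t \in s :: r]).
  + apply: measurableU; rewrite ?cylE.
      exact: (measurable_suffix_word [set t | t = s]).
    exact: (measurable_suffix_word [set t | t \in r]).
  + move=> w /=; rewrite inE => /orP[/eqP ws|]; [left|by right].
    by rewrite cylE /= -{1}ws size_suffix_word.
- rewrite cylE; exact: (measurable_suffix_word [set t | t = s]).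
- exact: (measurable_suffix_word [set t | t \in r]).
Qed.

(** A sequence without the factor [s0] lies in every [A k], whose measure is at most [q ^+ k]; this
    tends to 0 because [s0] has positive weight. *)
Lemma negligible_avoiding (s0 : seq X) :
  mu.-negligible [set w | ~ exists n a b, suffix_word w n = a ++ s0 ++ b].
Proof.
pose A k : set (borel_left_seq X) :=
  [set w | suffix_word w (k * size s0) \in block_avoiding s0 k].
have mA k : measurable (A k).
  exact: (measurable_suffix_word [set t | t \in block_avoiding s0 k]).
have mbA : measurable (\bigcap_k A k) by exact: bigcapT_measurable.
pose q := 1 - \prod_(x <- s0) p x.
have muA k : (mu (\bigcap_k A k) <= (q ^+ k)%:E)%E.
  rewrite -(sum_block_avoiding p_prob); apply: le_trans (mu_suffix_word_le _ _).
  by apply: le_measure; [exact: mem_set|exact: mem_set (mA k)|exact: bigcap_inf].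
have q_lt1 : `|q| < 1.
  rewrite ger0_norm.
    by rewrite gtrBl; apply: prodr_gt0.
  (* For [k = 1] the formula shows [q] as a sum of weights, hence nonnegative. *)
  rewrite -[q]expr1 -(sum_block_avoiding p_prob); apply: sumr_ge0 => s _.
  by apply: prodr_ge0 => x _; exact: ltW.
exists (\bigcap_k A k); split=> //.
  apply/eqP; rewrite eq_le measure_ge0 andbT.
  have q0 : (fun k => (q ^+ k)%:E) @ \oo --> (0 : \bar R)%E.
    by apply: cvg_EFin; [exact: nearW|exact: cvg_expr].
  rewrite -(cvg_lim _ q0)//; apply: lime_ge; first by apply/cvg_ex; exists 0%E.
  exact: nearW.
move=> w /= nos0 k _; rewrite /A /=.
have [|//|[a [b wab]]] :=
    @mem_block_avoiding X s0 k (suffix_word w (k * size s0)).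
  by rewrite size_suffix_word.
by case: nos0; exists (k * size s0)%N, a, b.
Qed.

End Bernoulli.

(** * The two minima and the integral of |V(w)| *)

Theorem theorem1 (R : realType) (X : pointedFinType) (p : X -> R)
    (p_prob : prob_vector p) (p_gt0 : forall x, 0 < p x)
    (mu : probability (borel_left_seq X) R) (mu_bernoulli : bernoulli_measure p mu)
    (G : lgraph X) (G_rr : right_resolving G) :
  exists m : nat,
    [/\ graph_measure G mu = m%:R%:E,
        is_min [set #|Vseq G w| | w in [set: left_seq X]] m
      & is_min [set #|Vword G s| | s in [set: seq X]] m].
Proof.
(* The empty word witnesses that the set of values |V(s)| is nonempty. *)
have [m /asboolP[s0 s0m] m_min] :
    ex_minn_spec (fun n => `[< exists s, #|Vword G s| = n >])
      (ex_minn (ex_intro (fun n => `[< exists s, #|Vword G s| = n >])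
         #|Vword G [::]| (asboolT (ex_intro _ [::] erefl)))).
  exact: ex_minnP.
have Vword_ge s : (m <= #|Vword G s|)%N by apply: m_min; apply/asboolP; exists s.
have Vseq_ge w : (m <= #|Vseq G w|)%N.
  have [n /subset_leq_card] := Vword_sub_Vseq G w; exact: leq_trans.
have VseqE w : (exists n a b, suffix_word w n = a ++ s0 ++ b) -> #|Vseq G w| = m.
  move=> [n [a [b wab]]]; apply/eqP; rewrite eqn_leq Vseq_ge andbT -s0m.
  apply: leq_trans (subset_leq_card (Vseq_sub_Vword G w n)) _.
  by rewrite wab card_Vword_factor.
exists m; split; last 2 first.
(* The minimum is attained at a sequence ending with [s0], reversed because index 0 holds the last
   letter; further left all letters are [point]. *)
- split=> [|_ [w _ <-]//]; exists (fun i => nth point (rev s0) i) => //.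
  apply: VseqE; exists (size s0), [::], [::]; rewrite cats0 /=.
  by rewrite /suffix_word -size_rev mkseq_nth revK.
- by split=> [|_ [s _ <-]//]; exists s0.
have mF (v : vert G) : measurable (Fset v : set (borel_left_seq X)) := measurable_Fset v.
have m1F (v : vert G) : measurable_fun [set: borel_left_seq X]
    (fun w => (\1_(Fset v) w)%:E : \bar R).
  exact/measurable_EFinP/measurable_indicP.
(* The integrand is |V(w)|, which equals [m] off the null set of sequences avoiding [s0]. *)
transitivity (\int[mu]_w \sum_(v : vert G) (\1_(Fset v) w)%:E)%E.
  rewrite /graph_measure ge0_integral_sum//.
  by apply: eq_bigr => v _; rewrite integral_indic// setIT.
transitivity (\int[mu]_w (cst m%:R%:E w))%E; last first.
  by rewrite integral_cst// [X in (_ * X)%E](probability_setT mu) mule1.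
apply: ge0_ae_eq_integral => //; first exact: emeasurable_sum.
- by move=> w _; apply: sume_ge0.
- by move=> w _; rewrite lee_fin.
apply: negligibleS (negligible_avoiding p_prob p_gt0 mu_bernoulli s0) => w /=.
apply: contra_not => /VseqE wm _.
rewrite /cst -wm sumEFin; congr EFin.
rewrite -sum1_card natr_sum [RHS]big_mkcond/=; apply: eq_bigr => v _.
rewrite indicE; case: VseqP => wv; first by rewrite mem_set.
by rewrite memNset.
Qed.
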